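(* For all $n\geq 0$: $d_7(4n+2)\equiv 0\pmod 4$, $d_7(8n+5)\equiv 0\pmod 4$, $d_7(16n+9)\equiv 0\pmod 4$, $d_7(4n+3)\equiv 0\pmod 8$, and $d_7(8n+4)\equiv 0\pmod 8$.
   Context: For each integer $k\geq 1$, the numbers $d_k(n)$ are defined by $\sum_{n\geq 0} d_k(n)q^n = \frac{f_2^k}{f_1^{3k+1}}$, where $f_r = \prod_{i\geq 1}(1-q^{ri})$. *)

(* Defs.v *)
From mathcomp Require Import all_boot all_order all_algebra.
Set Implicit Arguments. Unset Strict Implicit. Unset Printing Implicit Defensive.
Import GRing.Theory.
Local Open Scope ring_scope.

Definition fps := nat -> int.

Definition fps_one : fps := fun n => (n == 0%N)%:R.

Definition fps_mul (a b : fps) : fps :=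
  fun n => \sum_(i < n.+1) a i * b (n - i)%N.

Definition fps_pow (a : fps) (m : nat) : fps := iter m (fps_mul a) fps_one.

(* f_r = prod_{i>=1} (1 - q^(r i)).  The coefficient of q^n of the infinite
   product (r >= 1) equals that of the finite product over 1 <= i <= n. *)
Definition f (r : nat) : fps :=
  fun n => (\prod_(1 <= i < n.+1) (1 - 'X^(r * i)) : {poly int})`_n.

(* 1/f_1 = prod_{i>=1} 1/(1 - q^i) = prod_{i>=1} sum_{j>=0} q^(i j).
   Its coefficient of q^n equals that of the finite truncation
   prod_{1<=i<=n} sum_{0<=j<=n} q^(i j). *)
Definition f1inv : fps :=
  fun n => (\prod_(1 <= i < n.+1) \sum_(j < n.+1) 'X^(i * j) : {poly int})`_n.

Definition d (k : nat) : fps :=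
  fps_mul (fps_pow (f 2) k) (fps_pow f1inv (3 * k + 1)).

(* Main.v *)
(* Write phi(-q) = sum_s (-1)^s q^(s^2) = f_1^2 / f_2. Since phi = 1 + 2 x, one has
   phi^4 = 1 mod 8, and unfolding f_1^2 = f_2 phi(-q) three times gives
     sum_n d_7(n) q^n = f_2^7 / f_1^22
                      = phi(-q) phi(-q^2)^2 phi(-q^4)^3 / f_8   mod 8.
   The dissection phi(-q) = phi(q^4) - 2 q psi(q^8) then yields all 4-sections.
   The 3-section vanishes mod 8 and the 2-section mod 4. The 0-section is
   phi(q) phi(-q)^5 / f_2 = phi(q) phi(-q) / f_2 mod 8, an even series. The
   1-section is -2 psi(q^2) / f_2 mod 4, and psi / f_1 = f_2^2 / f_1^2 = f_2 mod 2
   is even. Both Gauss identities, f_1^2 = f_2 phi(-q) and f_1 psi(q) = f_2^2, come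
   from one finite identity in the style of Shanks, proved by telescoping. *)
Require Import Defs.
From mathcomp Require Import all_boot all_order all_algebra.
From mathcomp Require Import ring zify.
From Stdlib Require Import Setoid Morphisms.

Set Implicit Arguments. Unset Strict Implicit. Unset Printing Implicit Defensive.
Import GRing.Theory.
Local Open Scope ring_scope.

(** * Congruences between truncated power series *)

(** Congruence modulo m and q^(N+1). For [m = 0] it is equality of coefficients up to degree N, so
    exact identities pass to every modulus. *)
Definition eqm (m : int) (N : nat) (p q : {poly int}) : Prop :=
  forall i, (i <= N)%N -> (m %| (p - q)`_i)%Z.

Global Instance eqm_equiv (m : int) (N : nat) : Equivalence (eqm m N).
Proof.
split=> [p i _|p q pq i iN|p q r pq qr i iN]; first by rewrite subrr coef0 dvdz0.
  by rewrite -opprB coefN rpredN pq.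
by rewrite -(subrKA q p) coefD rpredD ?pq ?qr.
Qed.

Lemma eqm_eq (m : int) (N : nat) (p q : {poly int}) : p = q -> eqm m N p q.
Proof. by move=> ->; reflexivity. Qed.

Global Instance eqmD (m : int) (N : nat) :
  Proper (eqm m N ==> eqm m N ==> eqm m N) (@GRing.add {poly int}).
Proof.
move=> p p' pp q q' qq i iN.
by rewrite opprD addrACA coefD rpredD ?pp ?qq.
Qed.

Global Instance eqmN (m : int) (N : nat) :
  Proper (eqm m N ==> eqm m N) (@GRing.opp {poly int}).
Proof. by move=> p p' pp i iN; rewrite -opprD coefN rpredN pp. Qed.

Global Instance eqmM (m : int) (N : nat) :
  Proper (eqm m N ==> eqm m N ==> eqm m N) (@GRing.mul {poly int}).
Proof.
move=> p p' pp q q' qq i iN.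
have -> : p * q - p' * q' = (p - p') * q + p' * (q - q') by ring.
rewrite coefD !coefM rpredD // rpred_sum // => j _.
  by rewrite dvdz_mulr // pp // (leq_trans _ iN) // -ltnS.
by rewrite dvdz_mull // qq // (leq_trans (leq_subr _ _) iN).
Qed.

Global Instance eqmX (m : int) (N : nat) :
  Proper (eqm m N ==> eq ==> eqm m N) (@GRing.exp {poly int}).
Proof.
move=> p p' pp k _ <-; elim: k => [|k IH]; first by rewrite !expr0; reflexivity.
by rewrite !exprS; apply: eqmM.
Qed.

Lemma eqm_dvd (m m' : int) (N : nat) (p q : {poly int}) :
  (m' %| m)%Z -> eqm m N p q -> eqm m' N p q.
Proof. by move=> mm pq i iN; apply: dvdz_trans mm (pq _ iN). Qed.

Lemma eqm0 (m : int) (N : nat) (p q : {poly int}) : eqm 0 N p q -> eqm m N p q.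
Proof. exact: eqm_dvd (dvdz0 m). Qed.

Lemma eqm_leq (m : int) (N N' : nat) (p q : {poly int}) :
  (N' <= N)%N -> eqm m N p q -> eqm m N' p q.
Proof. by move=> NN pq i iN; apply: pq; apply: leq_trans NN. Qed.

Lemma eqm_scale (k m : int) (N : nat) (p q : {poly int}) :
  eqm m N p q -> eqm (k * m) N (k%:P * p) (k%:P * q).
Proof.
move=> pq i iN; rewrite -mulrBr coefCM; exact: dvdz_mul (dvdzz k) (pq _ iN).
Qed.

Lemma eqm_mulm (m : int) (N : nat) (p : {poly int}) : eqm m N (m%:P * p) 0.
Proof. by move=> i _; rewrite subr0 coefCM dvdz_mulr. Qed.

Lemma eqm_Xn (m : int) (N k : nat) (p : {poly int}) :
  (N < k)%N -> eqm m N ('X^k * p) 0.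
Proof. by move=> Nk i iN; rewrite subr0 coefXnM (leq_ltn_trans iN Nk) dvdz0. Qed.

Lemma eqm_comp (m : int) (N k : nat) (p q : {poly int}) : (0 < k)%N ->
  eqm m N p q -> eqm m N (p \Po 'X^k) (q \Po 'X^k).
Proof.
move=> k0 pq i iN; rewrite -comp_polyB coef_comp_poly_Xn //.
case: ifP => _; last exact: dvdz0.
by apply: pq; apply: leq_trans (leq_div _ _) iN.
Qed.

Lemma eqm_coef (m : int) (N i : nat) (p q : {poly int}) :
  eqm m N p q -> (i <= N)%N -> (m %| q`_i)%Z -> (m %| p`_i)%Z.
Proof. by move=> pq iN qi; rewrite -(subrK q p) coefD rpredD ?pq. Qed.

Lemma eqm_sum_nat (m : int) (N a b : nat) (F : nat -> {poly int}) :
  (forall i, (a <= i < b)%N -> eqm m N (F i) 0) ->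
  eqm m N (\sum_(a <= i < b) F i) 0.
Proof.
move=> F0; rewrite big_nat; elim/big_ind: _ => [|p q -> ->|//]; first reflexivity.
by rewrite addr0; reflexivity.
Qed.

Lemma eqm_prod_nat (m : int) (N a b : nat) (F : nat -> {poly int}) :
  (forall i, (a <= i < b)%N -> eqm m N (F i) 1) ->
  eqm m N (\prod_(a <= i < b) F i) 1.
Proof.
move=> F0; rewrite big_nat; elim/big_ind: _ => [|p q -> ->|//]; first reflexivity.
by rewrite mulr1; reflexivity.
Qed.

(** Frobenius modulo 2, by induction on the Horner form: the cross term carries a factor 2, and c^2
    = c mod 2 for an integer c. *)
Lemma eqm2_sqr (N : nat) (p : {poly int}) : eqm 2 N (p ^+ 2) (p \Po 'X^2).
Proof.
elim/poly_ind: p => [|p c IH]; first by rewrite comp_poly0 expr0n; reflexivity.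
rewrite comp_polyD comp_polyM comp_polyX comp_polyC -IH.
have c2 : eqm 2 N (c%:P ^+ 2) c%:P.
  move=> i _; rewrite -polyC_exp -polyCB coefC; case: ifP => _; last exact: dvdz0.
  have /orP[] : (2 %| c)%Z || (2 %| c - 1)%Z by lia.
    by move=> c2; rewrite expr2 rpredB ?dvdz_mulr.
  by move=> c2; rewrite (_ : _ - _ = c * (c - 1)) ?dvdz_mull //; ring.
have -> : (p * 'X + c%:P) ^+ 2
    = p ^+ 2 * 'X^2 + c%:P ^+ 2 + 2%:P * (p * 'X * c%:P) by ring.
by rewrite c2 eqm_mulm addr0; reflexivity.
Qed.

(* This form of 1 + 4 p + 4 p^2 depends on t = 1 + 2 p and t(q^2) only, so it
   can be transported along congruences between theta series. *)
Lemma eqm8_sqr (N : nat) (p t : {poly int}) : t = 1 + 2%:P * p ->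
  eqm 8 N (t ^+ 2) (2%:P * t + 2%:P * (t \Po 'X^2) - 3%:P).
Proof.
move=> ->; rewrite comp_polyD comp_polyM !comp_polyC.
have -> : (1 + 2%:P * p) ^+ 2 = 1 + (4%:P * p + 4%:P * p ^+ 2) by ring.
have /(eqm_scale 4) -> := @eqm2_sqr N p.
have -> : 1 + (4%:P * p + 4%:P * (p \Po 'X^2)) =
  2%:P * (1 + 2%:P * p) + 2%:P * (1%:P + 2%:P * (p \Po 'X^2)) - 3%:P by ring.
reflexivity.
Qed.

Lemma eqm8_pow4 (N : nat) (p : {poly int}) : eqm 8 N ((1 + 2%:P * p) ^+ 4) 1.
Proof.
have -> : (1 + 2%:P * p) ^+ 4
    = 1 + 8%:P * (p + 3%:P * p ^+ 2 + 4%:P * p ^+ 3 + 2%:P * p ^+ 4) by ring.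
by rewrite eqm_mulm addr0; reflexivity.
Qed.

(** * Theta series and Euler products *)

(** For e = 1 or -1, the two-sided sum of e^t q^(t^2) over |t| <= n, folded to expose the factor 2:
    phi(q) or phi(-q), truncated. *)
Definition theta (e : int) (n : nat) : {poly int} :=
  1 + 2%:P * \sum_(1 <= t < n.+1) (e ^+ t)%:P * 'X^(t ^ 2).

Definition psi (n : nat) : {poly int} := \sum_(0 <= t < n.+1) 'X^('C(t.+1, 2)).

Definition eulp (n r : nat) : {poly int} := \prod_(1 <= i < n.+1) (1 - 'X^(r * i)).

Lemma theta_stable (e : int) (N n : nat) : (N <= n)%N ->
  eqm 0 N (theta e n) (theta e N).
Proof.
move=> Nn; rewrite /theta (@big_cat_nat _ _ _ N.+1 1) //= (@eqm_sum_nat 0 N N.+1) //.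
  by rewrite addr0; reflexivity.
by move=> i /andP[Ni _]; rewrite mulrC; apply: eqm_Xn; nia.
Qed.

Lemma psi_stable (N n : nat) : (N <= n)%N -> eqm 0 N (psi n) (psi N).
Proof.
move=> Nn; rewrite /psi (@big_cat_nat _ _ _ N.+1 0) //= (@eqm_sum_nat 0 N N.+1) //.
  by rewrite addr0; reflexivity.
move=> i /andP[Ni _]; rewrite -['X^_]mulr1; apply: eqm_Xn.
by rewrite binS bin1; lia.
Qed.

Lemma eulp_stable (N n r : nat) : (0 < r)%N -> (N <= n)%N ->
  eqm 0 N (eulp n r) (eulp N r).
Proof.
move=> r0 Nn; rewrite /eulp (@big_cat_nat _ _ _ N.+1 1) //= (@eqm_prod_nat 0 N N.+1).
  by rewrite mulr1; reflexivity.
move=> i /andP[Ni _]; rewrite -['X^_]mulr1 eqm_Xn ?subr0; first reflexivity.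
by nia.
Qed.

Lemma eulp_comp (n r k : nat) : eulp n r \Po 'X^k = eulp n (k * r).
Proof.
rewrite /eulp rmorph_prod; apply: eq_bigr => i _ /=.
by rewrite comp_polyB comp_polyC comp_Xn_poly -exprM mulnA.
Qed.

Lemma thetaS (e : int) (n : nat) :
  theta e n.+1 = theta e n + 2%:P * ((e ^+ n.+1)%:P * 'X^(n.+1 ^ 2)).
Proof. by rewrite /theta big_nat_recr //= mulrDr addrA. Qed.

Lemma psiS (n : nat) : psi n.+1 = psi n + 'X^('C(n.+2, 2)).
Proof. by rewrite /psi big_nat_recr. Qed.

Lemma theta0 (e : int) : theta e 0 = 1.
Proof. by rewrite /theta big_geq // mulr0 addr0. Qed.

Lemma psi0 : psi 0 = 1.
Proof. by rewrite /psi big_nat1. Qed.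

(* Even squares are 4 t^2; odd squares are 1 + 8 C(t+1, 2). *)
Lemma theta_dissect (e : int) (n : nat) : e ^+ 2 = 1 ->
  theta e n.*2.+1 =
  (theta 1 n \Po 'X^4) + 2%:P * e%:P * 'X * (psi n \Po 'X^8).
Proof.
move=> e2.
have H t : 'X^(t.*2 ^ 2) = ('X^(t ^ 2) \Po 'X^4) :> {poly int}.
  by rewrite comp_Xn_poly -exprM; congr ('X^_); lia.
have K t : 'X^(t.*2.+1 ^ 2) = 'X * ('X^('C(t.+1, 2)) \Po 'X^8) :> {poly int}.
  rewrite comp_Xn_poly -exprM -exprS; congr ('X^_).
  have := mul_bin_diag t.+1 1; rewrite bin1 /=; nia.
elim: n => [|n IH].
  by rewrite thetaS !theta0 psi0 (K 0%N) expr1 !comp_polyC; ring.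
have e2n : e ^+ n.+1.*2 = 1 by rewrite -mul2n exprM e2 expr1n.
rewrite doubleS (thetaS e) (thetaS e) IH (thetaS 1) psiS -doubleS H K (exprS e) e2n expr1n.
rewrite !(comp_polyD, comp_polyM, comp_polyC); ring.
Qed.

(** * A finite form of the identities of Gauss *)

(* With x = b z, the base of the q-series: (a, b, z) = (-1, 1, q) gives the sum over
   (-1)^s q^(s^2), and (1, q, q) gives the sum over q^(s(s+1)/2). *)
Definition shanks (R : comNzRingType) (a b z : R) (n : nat) : R :=
  \sum_(0 <= s < n.+1) (\prod_(0 <= i < s) (a - b * (b * z) ^+ i)) *
    (\prod_(s <= i < n) (1 - (b * z) ^+ i.+1)) * (z * (b * z) ^+ n) ^+ s.

Lemma shanks0 (R : comNzRingType) (a b z : R) : shanks a b z 0 = 1.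
Proof. by rewrite /shanks big_nat1 !big_geq // expr0 !mulr1. Qed.

(** Put x = b z and u = z x^n. The difference of the two sums telescopes over s <= n; its boundary
    term and the new top term s = n+1 together give the factor 1 + x^(n+1). *)
Lemma shanksS (R : comNzRingType) (a b z : R) (n : nat) :
  shanks a b z n.+1 = (1 - a * (z * (b * z) ^+ n)) * shanks a b z n +
    (\prod_(0 <= i < n.+1) (a - b * (b * z) ^+ i)) *
      (z * (b * z) ^+ n) ^+ n.+1 * (1 + (b * z) ^+ n.+1).
Proof.
pose w s : R := \prod_(0 <= i < s) (a - b * (b * z) ^+ i).
pose C s : R := \prod_(s <= i < n) (1 - (b * z) ^+ i.+1).
pose u := z * (b * z) ^+ n.
pose y s := if s is s'.+1 then w s * C s' * u ^+ s else 0.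
rewrite {1}/shanks big_nat_recr //= [X in _ * X * _]big_geq // mulr1 -/(w n.+1).
have uS : z * (b * z) ^+ n.+1 = u * (b * z) by rewrite /u exprS; ring.
rewrite uS -/u.
apply: (addIr (- ((1 - a * u) * shanks a b z n))).
rewrite addrAC /shanks mulr_sumr -sumrB.
rewrite (@GRing.telescope_sumr_eq _ _ _ y) //; last first.
  move=> s /andP[_ sn]; rewrite (big_nat_recr n s) //= -/(C s) -/(w s) -/u.
  rewrite (exprMn _ u).
  have wS : w s.+1 = w s * (a - b * (b * z) ^+ s) by rewrite /w big_nat_recr.
  have xn : (b * z) ^+ n.+1 = b * u by rewrite exprS /u; ring.
  rewrite {1}/y wS xn exprS.
  case: s sn {wS} => [|s] sn.
    rewrite /y !expr0; ring.
  have CS : C s = (1 - (b * z) ^+ s.+1) * C s.+1 by rewrite /C big_ltn.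
  by rewrite /y CS; ring.
rewrite [RHS]addrAC subrr add0r /= /C big_geq // mulr1 subr0 (exprMn _ u); ring.
Qed.

(** Every term with s >= 1 contains z (b z)^n, hence q^(N+1); only s = 0 survives. *)
Lemma eqm_shanks (N n : nat) (a b z v : {poly int}) :
  z * (b * z) ^+ n = 'X^(N.+1) * v ->
  eqm 0 N (shanks a b z n) (\prod_(0 <= i < n) (1 - (b * z) ^+ i.+1)).
Proof.
move=> zN; rewrite /shanks (big_ltn (ltn0Sn n)) (big_geq (leqnn 0)).
rewrite expr0 mul1r mulr1 (@eqm_sum_nat 0 N 1).
  by rewrite addr0; reflexivity.
move=> [//|s] _; rewrite exprS zN.
rewrite -!mulrA (mulrCA _ 'X^_) (mulrCA _ 'X^_); exact: eqm_Xn.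
Qed.

(** The recurrence adds one theta term per step: the factor i = 0 of the product is -2, which
    supplies the 2, and u^(n+1) = q^((n+1)^2). *)
Lemma shanks_theta (n : nat) :
  shanks (- 1) 1 'X n =
  (\prod_(1 <= i < n.+1) (1 + 'X^i)) * theta (- 1) n :> {poly int}.
Proof.
elim: n => [|n IH]; first by rewrite shanks0 theta0 big_geq // mulr1.
have w : \prod_(0 <= i < n.+1) (- 1 - 1 * (1 * 'X) ^+ i)
    = 2%:P * (- 1) ^+ n.+1 * \prod_(1 <= i < n.+1) (1 + 'X^i) :> {poly int}.
  elim: n {IH} => [|n IH]; first by rewrite big_nat1 big_geq //; ring.
  by rewrite big_nat_recr //= IH (big_nat_recr n.+1 1) //= !mul1r (exprS _ n.+1); ring.
rewrite shanksS IH w thetaS (big_nat_recr n.+1 1) //= !mul1r.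
rewrite expnS expn1 exprM polyC_exp polyCN -exprS; ring.
Qed.

(** Here u = q^(2n+1) and x = q^2, so u^(n+1) (1 + x^(n+1)) contributes two consecutive triangular
    exponents; hence the index 2n on the right. *)
Lemma shanks_psi (n : nat) :
  shanks 1 'X 'X n =
  (\prod_(0 <= i < n) (1 - 'X * ('X * 'X) ^+ i)) * psi n.*2 :> {poly int}.
Proof.
elim: n => [|n IH]; first by rewrite shanks0 psi0 big_geq // mulr1.
have E m : ('X * 'X) ^+ m = 'X^(m.*2) :> {poly int} by rewrite -expr2 -exprM mul2n.
rewrite shanksS IH doubleS !psiS big_nat_recr //= mul1r !E -!exprS.
have -> : 'C(n.*2.+2, 2) = (n.*2.+1 * n.+1)%N by rewrite bin2 /=; nia.
have -> : 'C(n.*2.+3, 2) = (n.*2.+1 * n.+1 + n.+1.*2)%N by rewrite bin2 /=; nia.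
rewrite exprD exprM; ring.
Qed.

Lemma eulpS (n r : nat) : eulp n.+1 r = eulp n r * (1 - 'X^(r * n.+1)).
Proof. by rewrite /eulp big_nat_recr. Qed.

Lemma eulp_sqr (N : nat) :
  eqm 0 N (eulp N 1 ^+ 2) (eulp N 2 * theta (- 1) N).
Proof.
have zN : 'X * (1 * 'X) ^+ N = 'X^(N.+1) * 1 :> {poly int}.
  by rewrite mul1r mulr1 -exprS.
have := eqm_shanks (- 1) zN; rewrite shanks_theta.
have -> : \prod_(0 <= i < N) (1 - (1 * 'X) ^+ i.+1) = eulp N 1.
  by rewrite /eulp big_add1; apply: eq_bigr => i _; rewrite !mul1r mul1n.
have -> : eulp N 2 = eulp N 1 * \prod_(1 <= i < N.+1) (1 + 'X^i).
  rewrite -big_split; apply: eq_bigr => i _ /=.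
  by rewrite mul1n mulnC exprM; ring.
by move=> H; rewrite -mulrA H -expr2; reflexivity.
Qed.

Lemma eulp_psi (N : nat) : eqm 0 N (eulp N 1 * psi N) (eulp N 2 ^+ 2).
Proof.
have zN : 'X * ('X * 'X) ^+ N = 'X^(N.+1) * 'X^N :> {poly int}.
  by rewrite exprMn exprS mulrA.
have := eqm_shanks 1 zN; rewrite shanks_psi.
have -> : \prod_(0 <= i < N) (1 - ('X * 'X) ^+ i.+1) = eulp N 2.
  by rewrite /eulp big_add1; apply: eq_bigr => i _; rewrite -expr2 -exprM.
set e := \prod_(0 <= i < N) _ => H.
have NN : (N <= N.*2)%N by rewrite -addnn leq_addr.
(* [e] collects the odd exponents below 2N and [eulp N 2] the even ones up to 2N. *)
have eE : e * eulp N 2 = eulp N.*2 1.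
  rewrite /e; elim: N {zN e H NN} => [|n IH]; first by rewrite /eulp !big_geq ?mulr1.
  rewrite doubleS !eulpS -IH big_nat_recr //=.
  rewrite -expr2 -exprM -exprS !mul1n !mul2n -doubleS; ring.
rewrite -(eulp_stable _ NN) // -eE -(psi_stable NN).
have -> : e * eulp N 2 * psi N.*2 = eulp N 2 * (e * psi N.*2) by ring.
by rewrite H -expr2; reflexivity.
Qed.

(** * The inverse Euler product and polynomial truncations of the series [d k] *)

Definition invp (n : nat) : {poly int} :=
  \prod_(1 <= i < n.+1) \sum_(j < n.+1) 'X^(i * j).

Lemma eulp_invp (N : nat) : eqm 0 N (eulp N 1 * invp N) 1.
Proof.
rewrite -big_split /=; apply: eqm_prod_nat => i /andP[i0 _].
have -> : (1 - 'X^(1 * i)) * \sum_(j < N.+1) 'X^(i * j) = 1 - 'X^(i * N.+1) * 1 :> {poly int}.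
  rewrite mulr1 mul1n exprM -[RHS]opprB subrX1 -mulNr opprB; congr (_ * _).
  by apply: eq_bigr => j _; rewrite exprM.
by rewrite eqm_Xn ?subr0; [reflexivity|rewrite leq_pmull].
Qed.

(** The inner sums grow with n too, so no tail product splits off. Instead, both sides invert the
    same Euler product up to degree N. *)
Lemma invp_stable (N n : nat) : (N <= n)%N -> eqm 0 N (invp n) (invp N).
Proof.
move=> Nn; rewrite -[X in eqm _ _ X _]mul1r -(@eulp_invp N) -(eulp_stable _ Nn) //.
have -> : eulp n 1 * invp N * invp n = invp N * (eulp n 1 * invp n) by ring.
by rewrite (eqm_leq Nn (@eulp_invp n)) mulr1; reflexivity.
Qed.

Lemma eqm0_coef (N : nat) (p q : {poly int}) : eqm 0 N p q -> p`_N = q`_N.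
Proof.
by move=> /(_ N (leqnn N)); rewrite dvd0z coefB subr_eq0 => /eqP.
Qed.

Definition trunc (N : nat) (a : fps) (p : {poly int}) : Prop :=
  forall i, (i <= N)%N -> a i = p`_i.

Lemma trunc_mul (N : nat) (a b : fps) (p q : {poly int}) :
  trunc N a p -> trunc N b q -> trunc N (fps_mul a b) (p * q).
Proof.
move=> ap bq i iN; rewrite coefM; apply: eq_bigr => j _.
by rewrite ap ?bq // (leq_trans _ iN) ?leq_subr // -ltnS.
Qed.

Lemma trunc_pow (N : nat) (a : fps) (p : {poly int}) (k : nat) :
  trunc N a p -> trunc N (fps_pow a k) (p ^+ k).
Proof.
move=> ap; elim: k => [|k IH]; first by move=> i _; rewrite coef1.
by rewrite exprS; apply: trunc_mul.
Qed.

Lemma trunc_d (N k : nat) :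
  trunc N (d k) (eulp N 2 ^+ k * invp N ^+ (3 * k + 1)).
Proof.
apply: trunc_mul; apply: trunc_pow => i iN; apply: eqm0_coef; symmetry.
  exact: eulp_stable.
exact: invp_stable.
Qed.

Lemma comp_XnXn (p : {poly int}) (a b : nat) :
  (p \Po 'X^a) \Po 'X^b = p \Po 'X^(b * a).
Proof. by rewrite -comp_polyA comp_Xn_poly -exprM. Qed.

Lemma comp_poly_exp (p q : {poly int}) (k : nat) :
  (p ^+ k) \Po q = (p \Po q) ^+ k.
Proof. exact: rmorphXn. Qed.

Lemma coef_XnM_comp (p : {poly int}) (k r s n : nat) : (r < k)%N -> (s < k)%N ->
  ('X^r * (p \Po 'X^k))`_(k * n + s)%N = if r == s then p`_n else 0.
Proof.
move=> rk sk; have k0 : (0 < k)%N by apply: leq_ltn_trans sk.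
rewrite coefXnM coef_comp_poly_Xn //.
have [<-|rs] := eqVneq r s.
  by rewrite ltnNge leq_addl /= addnK dvdn_mulr // mulKn.
case: ltnP => // rkn; case: ifP => // /dvdnP[m E].
have : (k * n + s = m * k + r)%N by lia.
move/(congr1 (modn^~ k)).
by rewrite mulnC !modnMDl !modn_small // => sr; rewrite sr eqxx in rs.
Qed.

(** * The generating function modulo 8 *)

Lemma theta_pow4 (N n k : nat) (e : int) :
  eqm 8 N ((theta e n \Po 'X^k) ^+ 4) 1.
Proof.
by rewrite /theta comp_polyD comp_polyM !comp_polyC; apply: eqm8_pow4.
Qed.

Lemma d7_theta (N : nat) :
  eqm 8 N (eulp N 2 ^+ 7 * invp N ^+ 22)
    (theta (- 1) N * (theta (- 1) N \Po 'X^2) ^+ 2 *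
      (theta (- 1) N \Po 'X^4) ^+ 3 * (invp N \Po 'X^8)).
Proof.
set t := theta (- 1) N; set G := invp N.
have E12 : eqm 8 N (eulp N 1 ^+ 2) (eulp N 2 * t) by apply/eqm0/eulp_sqr.
have E24 : eqm 8 N (eulp N 2 ^+ 2) (eulp N 4 * (t \Po 'X^2)).
  by move: (@eqm_comp 8 N 2 _ _ isT E12); rewrite comp_poly_exp comp_polyM !eulp_comp; apply.
have E48 : eqm 8 N (eulp N 4 ^+ 2) (eulp N 8 * (t \Po 'X^4)).
  by move: (@eqm_comp 8 N 4 _ _ isT E12); rewrite comp_poly_exp comp_polyM !eulp_comp; apply.
have EG : eqm 8 N (eulp N 1 * G) 1 by apply/eqm0/eulp_invp.
have EG8 : eqm 8 N (eulp N 8 * (G \Po 'X^8)) 1.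
  move: (@eqm_comp 8 N 8 _ _ isT EG).
  by rewrite comp_polyM comp_polyC eulp_comp; apply.
have t1 : eqm 8 N (t ^+ 4) 1 by have := @theta_pow4 N N 1 (- 1); rewrite comp_polyXr.
have t2 := @theta_pow4 N N 2 (- 1); have t4 := @theta_pow4 N N 4 (- 1).
rewrite -/t in t2 t4.
set T := t * _ * _ * _.
(* All inserted factors are 1 mod 8. Beyond [T] they leave f_8 phi(-q^4) phi(-q^2)^2 phi(-q)^11,
   just enough for the three relations to turn f_2^7 into f_1^22, which cancels [G ^+ 22]. *)
transitivity (eulp N 2 ^+ 7 * G ^+ 22 * (eulp N 8 * (G \Po 'X^8)) *
   ((t ^+ 4) ^+ 3 * (t \Po 'X^2) ^+ 4 * (t \Po 'X^4) ^+ 4)).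
  by rewrite EG8 t1 t2 t4 expr1n !mulr1; reflexivity.
have -> : eulp N 2 ^+ 7 * G ^+ 22 * (eulp N 8 * (G \Po 'X^8)) *
   ((t ^+ 4) ^+ 3 * (t \Po 'X^2) ^+ 4 * (t \Po 'X^4) ^+ 4) =
   eulp N 2 ^+ 7 * G ^+ 22 * (eulp N 8 * (t \Po 'X^4)) *
     (t \Po 'X^2) ^+ 2 * t ^+ 11 * T by rewrite /T; ring.
rewrite -E48.
have -> : eulp N 2 ^+ 7 * G ^+ 22 * eulp N 4 ^+ 2 * (t \Po 'X^2) ^+ 2 * t ^+ 11 * T =
   eulp N 2 ^+ 7 * G ^+ 22 * (eulp N 4 * (t \Po 'X^2)) ^+ 2 * t ^+ 11 * T by ring.
rewrite -E24.
have -> : eulp N 2 ^+ 7 * G ^+ 22 * (eulp N 2 ^+ 2) ^+ 2 * t ^+ 11 * T =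
   (eulp N 2 * t) ^+ 11 * G ^+ 22 * T by ring.
rewrite -E12 -exprM -exprMn EG expr1n mul1r; reflexivity.
Qed.

Lemma theta1_split (N : nat) :
  eqm 0 N (theta 1 N) ((theta 1 N \Po 'X^4) + 2%:P * 'X * (psi N \Po 'X^8)).
Proof.
have NN : (N <= N.*2.+1)%N by lia.
rewrite -{1}(theta_stable 1 NN) theta_dissect ?expr1n //.
by rewrite mulr1; reflexivity.
Qed.

Lemma thetaN_split (N : nat) :
  eqm 0 N (theta (- 1) N)
    ((theta 1 N \Po 'X^4) - 2%:P * 'X * (psi N \Po 'X^8)).
Proof.
have NN : (N <= N.*2.+1)%N by lia.
rewrite -(theta_stable (- 1) NN) theta_dissect ?sqrrN ?expr1n //.
by rewrite polyCN mulrN1 !mulNr; reflexivity.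
Qed.

(** Classically phi(-q)^2 = phi(q^2)^2 - 4 q psi(q^4)^2, and the sign is immaterial mod 8.
    [eqm8_sqr] makes both squares linear in theta series, and 2 phi(-q) = 2 phi(q) mod 8 by the
    dissections. *)
Lemma thetaN_sqr (N : nat) :
  eqm 8 N (theta (- 1) N ^+ 2)
    ((theta 1 N \Po 'X^2) ^+ 2 + 4%:P * 'X * (psi N \Po 'X^4) ^+ 2).
Proof.
set A := theta 1 N; set B := psi N; set t := theta (- 1) N.
have tA : eqm 8 N (2%:P * t) (2%:P * A).
  transitivity (2%:P * ((A \Po 'X^4) + 2%:P * 'X * (B \Po 'X^8))); last first.
    by rewrite -(eqm0 8 (@theta1_split N)); reflexivity.
  rewrite /t (eqm0 8 (@thetaN_split N)) -/A -/B.
  have -> : 2%:P * ((A \Po 'X^4) - 2%:P * 'X * (B \Po 'X^8)) =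
    2%:P * ((A \Po 'X^4) + 2%:P * 'X * (B \Po 'X^8)) +
    8%:P * (- ('X * (B \Po 'X^8))) by ring.
  by rewrite (@eqm_mulm 8) addr0; reflexivity.
have tA2 : eqm 8 N (2%:P * (t \Po 'X^2)) (2%:P * (A \Po 'X^2)).
  by move: (@eqm_comp 8 N 2 _ _ isT tA); rewrite !comp_polyM !comp_polyC; apply.
have A2 : eqm 8 N ((A \Po 'X^2) ^+ 2)
    (2%:P * (A \Po 'X^2) + 2%:P * (A \Po 'X^4) - 3%:P).
  rewrite (@eqm8_sqr N _ (A \Po 'X^2)); first by rewrite comp_XnXn; reflexivity.
  by rewrite /A /theta comp_polyD comp_polyM !comp_polyC.
have B48 : eqm 8 N (4%:P * (B \Po 'X^4) ^+ 2) (4%:P * (B \Po 'X^8)).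
  have /(eqm_scale 4) := @eqm2_sqr N (B \Po 'X^4); by rewrite comp_XnXn.
rewrite (@eqm8_sqr N _ t erefl) tA tA2 A2.
have -> : 4%:P * 'X * (B \Po 'X^4) ^+ 2 = 'X * (4%:P * (B \Po 'X^4) ^+ 2) by ring.
have A1 := eqm0 8 (@theta1_split N); rewrite -/A -/B in A1.
rewrite B48 {1}A1.
by apply: eqm_eq; ring.
Qed.

(** * The sections modulo 4 and their parity *)

Definition odd_dvd (m : int) (N : nat) (p : {poly int}) : Prop :=
  forall n, (2 * n + 1 <= N)%N -> (m %| p`_(2 * n + 1)%N)%Z.

Lemma odd_dvd_comp (m : int) (N : nat) (p q : {poly int}) :
  eqm m N p (q \Po 'X^2) -> odd_dvd m N p.
Proof.
move=> pq n nN; apply: eqm_coef pq nN _.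
by rewrite coef_comp_poly_Xn //; case: ifP => [|_]; [lia|exact: dvdz0].
Qed.

(* The coefficients of d_7(4n) and of d_7(4n+1) / -2, modulo 8 and 4 respectively. *)
Definition dissect0 (N : nat) : {poly int} :=
  theta 1 N * ((theta 1 N \Po 'X^2) ^+ 2 + 4%:P * 'X * (psi N \Po 'X^4) ^+ 2) *
    theta (- 1) N ^+ 3 * (invp N \Po 'X^2).

Definition dissect1 (N : nat) : {poly int} :=
  (psi N \Po 'X^2) *
    ((theta 1 N \Po 'X^2) ^+ 2 + 4%:P * 'X * (psi N \Po 'X^4) ^+ 2) *
    theta (- 1) N ^+ 3 * (invp N \Po 'X^2).

(** The bracket is phi(-q)^2 by [thetaN_sqr], and phi(-q)^4 = 1 drops out. What remains has phi(q)
    phi(-q) = phi(q^4)^2 - 4 q^2 psi(q^8)^2, which is even. *)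
Lemma dissect0_even (N : nat) : odd_dvd 8 N (dissect0 N).
Proof.
rewrite /dissect0.
set A := theta 1 N; set B := psi N; set t := theta (- 1) N; set G := invp N.
apply: (@odd_dvd_comp _ _ _ (((A \Po 'X^2) ^+ 2 - 4%:P * 'X * (B \Po 'X^4) ^+ 2) * G)).
rewrite -thetaN_sqr -/t.
have -> : A * t ^+ 2 * t ^+ 3 * (G \Po 'X^2) = t ^+ 4 * (A * t * (G \Po 'X^2)) by ring.
have := @theta_pow4 N N 1 (- 1); rewrite comp_polyXr -/t => ->.
have A1 := eqm0 8 (@theta1_split N); rewrite -/A -/B in A1.
have t1 := eqm0 8 (@thetaN_split N); rewrite -/A -/B -/t in t1.
rewrite t1 {1}A1.
rewrite !(comp_poly_exp, comp_polyM, comp_polyB, comp_polyC, comp_polyX, comp_XnXn).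
by apply: eqm_eq; ring.
Qed.

Lemma psi_invp_even (N : nat) : odd_dvd 2 N (psi N * invp N).
Proof.
apply: (@odd_dvd_comp _ _ _ (eulp N 1)); rewrite eulp_comp muln1.
set G := invp N.
have EG : eqm 2 N (eulp N 1 * G) 1 by apply/eqm0/eulp_invp.
have E2 : eqm 2 N (eulp N 1 ^+ 2) (eulp N 2) by rewrite eqm2_sqr eulp_comp; reflexivity.
(* Inserting f_1 / f_1 creates the product f_1 psi, to which Gauss applies. *)
transitivity (eulp N 1 * G * (psi N * G)); first by rewrite EG mul1r; reflexivity.
have -> : eulp N 1 * G * (psi N * G) = eulp N 1 * psi N * G ^+ 2 by ring.
rewrite (eqm0 2 (@eulp_psi N)) -E2.
have -> : (eulp N 1 ^+ 2) ^+ 2 * G ^+ 2 = (eulp N 1 * G) ^+ 2 * eulp N 1 ^+ 2 by ring.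
by rewrite EG expr1n mul1r; reflexivity.
Qed.

(** Theta series are 1 mod 2, leaving psi(q^2) / f_2. Its evenness serves 8n+5; its even part, psi /
    f_1, serves 16n+9. *)
Lemma dissect1_mod2 (N : nat) :
  eqm 2 N (dissect1 N) ((psi N * invp N) \Po 'X^2).
Proof.
rewrite /dissect1.
have th e k : eqm 2 N (theta e N \Po 'X^k) 1.
  rewrite comp_polyD comp_polyM !comp_polyC (@eqm_mulm 2) addr0; reflexivity.
have := th (- 1) 1; rewrite comp_polyXr => ->.
rewrite th comp_polyM.
have -> : 4%:P * 'X * (psi N \Po 'X^4) ^+ 2 = 2%:P * (2%:P * 'X * (psi N \Po 'X^4) ^+ 2) by ring.
by rewrite (@eqm_mulm 2) addr0 !expr1n !mulr1; reflexivity.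
Qed.

(** Only phi(-q) and phi(-q^2)^2 need dissecting; the other factors are series in q^4. The witness
    is the cofactor of -4 q^2, from the cross term of the square, and the only q^3 term has
    coefficient 8. *)
Lemma d7_dissect (N : nat) : exists C2 : {poly int},
  eqm 8 N (eulp N 2 ^+ 7 * invp N ^+ 22)
   ('X^0 * (dissect0 N \Po 'X^4) - 2%:P * ('X^1 * (dissect1 N \Po 'X^4)) -
    4%:P * ('X^2 * (C2 \Po 'X^4))).
Proof.
rewrite /dissect0 /dissect1.
set A := theta 1 N; set B := psi N; set t := theta (- 1) N; set G := invp N.
exists (A * (A \Po 'X^2) * (B \Po 'X^4) * t ^+ 3 * (G \Po 'X^2)) .
rewrite d7_theta -/t -/G.
have t1 : eqm 8 N t ((A \Po 'X^4) - 2%:P * 'X * (B \Po 'X^8)).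
  exact: eqm0 (@thetaN_split N).
have t2 : eqm 8 N (t \Po 'X^2) ((A \Po 'X^8) - 2%:P * 'X^2 * (B \Po 'X^16)).
  move: (@eqm_comp 8 N 2 _ _ isT t1).
  by rewrite comp_polyB !comp_polyM comp_polyC comp_polyX !comp_XnXn; apply.
rewrite {1}t1 t2; clearbody A B t G.
rewrite !(comp_poly_exp, comp_polyM, comp_polyD, comp_polyC, comp_polyX, comp_XnXn).
rewrite -[(4 * 2)%N]/8%N -[(4 * 4)%N]/16%N.
set L := (X in eqm 8 N X _); set R := (X in eqm 8 N _ X).
have -> : L = R + 8%:P * ('X ^+ 3 * (A \Po 'X^8) * (B \Po 'X^8) * (B \Po 'X^16) *
   (t \Po 'X^4) ^+ 3 * (G \Po 'X^8)) by rewrite /L /R; ring.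
by rewrite (@eqm_mulm 8) addr0; reflexivity.
Qed.

(** The list covers r = 0, 1, 2; the default 0 of [nth] is the vanishing section r = 3. *)
Lemma d7_coef (N n r : nat) : (4 * n + r <= N)%N -> (r < 4)%N ->
  exists c : int, (8 %| d 7 (4 * n + r)%N -
    nth 0 [:: (dissect0 N)`_n; - 2 * (dissect1 N)`_n; 4 * c] r)%Z.
Proof.
move=> nN r4; have [C2 /(_ _ nN) H] := d7_dissect N.
exists (- C2`_n); rewrite (@trunc_d N 7 _ nN); move: H.
rewrite !coefB (coef_XnM_comp (dissect0 N)) // !coefCM !coef_XnM_comp //.
by case: r {nN} r4 => [|[|[|[|//]]]] _ /=;
  rewrite ?mulr0 ?subr0 ?sub0r ?mulNr ?mulrN.
Qed.

Lemma dvdz4_of_dvdz8 (x y : int) :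
  (2 %| x)%Z -> (8 %| y - - 2 * x)%Z -> (4 %| y)%Z.
Proof. by lia. Qed.

Theorem theorem3p4 :
  forall n : nat,
    [/\ (4 %| d 7 (4 * n + 2)%N)%Z,
        (4 %| d 7 (8 * n + 5)%N)%Z,
        (4 %| d 7 (16 * n + 9)%N)%Z,
        (8 %| d 7 (4 * n + 3)%N)%Z &
        (8 %| d 7 (8 * n + 4)%N)%Z].
Proof.
move=> n; split.
- have [c /=] := @d7_coef _ n 2 (leqnn _) isT; lia.
- have -> : (8 * n + 5 = 4 * (2 * n + 1) + 1)%N by lia.
  set m := (4 * _ + 1)%N.
  have [c /=] := @d7_coef _ (2 * n + 1) 1 (leqnn m) isT; apply: dvdz4_of_dvdz8.
  by apply: (odd_dvd_comp (@dissect1_mod2 m)); rewrite /m; lia.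
(* The even index 2(2n+1) of [dissect1] reads off the odd coefficient 2n+1 of psi / f_1. *)
- have -> : (16 * n + 9 = 4 * (2 * n + 1).*2 + 1)%N by lia.
  set m := (4 * _ + 1)%N.
  have [c /=] := @d7_coef _ (2 * n + 1).*2 1 (leqnn m) isT; apply: dvdz4_of_dvdz8.
  apply: eqm_coef (@dissect1_mod2 m) _ _; first by rewrite /m; lia.
  rewrite coef_comp_poly_Xn // -muln2 dvdn_mull // mulnK //.
  by apply: psi_invp_even; rewrite /m; lia.
- by have [c /=] := @d7_coef _ n 3 (leqnn _) isT; rewrite subr0.
- have -> : (8 * n + 4 = 4 * (2 * n + 1) + 0)%N by lia.
  set m := (4 * _ + 0)%N.
  have [c /=] := @d7_coef _ (2 * n + 1) 0 (leqnn m) isT.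
  rewrite rpredBr //; apply: dissect0_even; rewrite /m; lia.
Qed.
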